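(* For $m>\sqrt{5/3}$ let $$\Psi_m^5(z)=[1+pz^2,\;pz^3+z^5,\;mz+nz^3,\;-nz^2-mz^4],\qquad n=3\sqrt{\frac{3m^2-5}{m^2+9}},\quad p=\frac{nm}{3},$$ and let $h_m$ be the conformal factor of the metric induced by $\Psi_m^5$ with respect to the canonical metric. Then, as $m\to+\infty$, $h_m$ converges weakly on $\mathbb{R}P^2$ to $4\pi\delta+3$, where $\delta$ is the Dirac delta at the point $z=0$; that is, for every continuous function $u$ on $\mathbb{R}P^2$, $$\lim_{m\to+\infty}\int_{\mathbb{R}P^2}u\,h_m\,dA=4\pi\,u([0])+3\int_{\mathbb{R}P^2}u\,dA .$$
   Context: Identify $S^2=\mathbb{C}P^1=\mathbb{C}\cup\{\infty\}$ with coordinate $z=x+iy$, so that the antipodal map is $z\mapsto-1/\bar z$; $\mathbb{R}P^2$ is the quotient by it, represented by the disk $|z|\le1$ with antipodal boundary points identified, and $[0]\in\mathbb{R}P^2$ is the class of $z=0$. The canonical metric is $g_{can}=4\frac{dx^2+dy^2}{(1+|z|^2)^2}$, which has area $4\pi$ on $S^2$ and descends to a metric of area $2\pi$ on $\mathbb{R}P^2$, with area element $dA=\frac{4\,dx\,dy}{(1+|z|^2)^2}$. $\mathbb{C}P^3$ carries the Fubini-Study metric of constant holomorphic sectional curvature $1$ (i.e. the real part of $4\frac{|\mathbf{Z}|^2|d\mathbf{Z}|^2-(\bar{\mathbf{Z}},d\mathbf{Z})(\mathbf{Z},d\bar{\mathbf{Z}})}{|\mathbf{Z}|^4}$). The metric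 $g_{ind;m}$ is the pullback of this metric under the holomorphic curve $\Psi_m^5:S^2\to\mathbb{C}P^3$; it coincides with the metric induced by the harmonic map $\pi\circ\Psi_m^5:S^2\to S^4$, where $\pi:\mathbb{C}P^3\to S^4$ is the twistor fibration (a Riemannian submersion to whose fibers $\Psi_m^5$ is orthogonal). This metric is invariant under the antipodal map, so it descends to $\mathbb{R}P^2$. The conformal factor $h_m$ is defined by $g_{ind;m}=h_m\,g_{can}$. *)

(* Defs.v *)
From HB Require Import structures.
From mathcomp Require Import all_boot all_order all_algebra.
From mathcomp Require Import generic_quotient complex.
From mathcomp Require Import all_classical all_reals all_analysis.

Set Implicit Arguments.
Unset Strict Implicit.
Unset Printing Implicit Defensive.

Import Order.TTheory GRing.Theory Num.Theory numFieldNormedType.Exports.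

Local Open Scope classical_set_scope.
Local Open Scope ring_scope.
Local Open Scope complex_scope.

(* The finite points of S^2 = C u {oo} are real pairs (x, y), which carry the
   topology, the Lebesgue measure and the directional derivatives; algebra is
   done in R[i] after the identification (x, y) |-> x + iy. *)

Definition toC {R : realType} (q : R * R) : R[i] := q.1 +i* q.2.

Definition ofC {R : realType} (z : R[i]) : R * R := (complex.Re z, complex.Im z).

Definition S2 (R : realType) := one_point_compactification (R * R)%type.

(* z |-> - 1 / conj z, exchanging 0 and oo *)
Definition antipode {R : realType} (p : S2 R) : S2 R :=
  match p with
  | Some q => if q == 0 then None else Some (ofC (- (conjc (toC q))^-1))
  | None => Some 0
  end.

Lemma toCK {R : realType} : cancel (@toC R) (@ofC R).
Proof. by case. Qed.

Lemma ofCK {R : realType} : cancel (@ofC R) (@toC R).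
Proof. by case. Qed.

Lemma toC_eq0 {R : realType} (q : R * R) : (toC q == 0) = (q == 0).
Proof. by rewrite -(inj_eq (can_inj toCK)). Qed.

Lemma antipodeE {R : realType} (q : R * R) : q != 0 ->
  antipode (Some q) = Some (ofC (- (conjc (toC q))^-1)).
Proof. by move=> /negPf q0; rewrite /antipode q0. Qed.

Lemma antipodeK {R : realType} : involutive (@antipode R).
Proof.
case=> [q|]; last by rewrite /= eqxx.
have [-> /=|q0] := eqVneq q 0; first by rewrite eqxx.
rewrite antipodeE // antipodeE; last first.
  by rewrite -toC_eq0 ofCK oppr_eq0 invr_eq0 conjc_eq0 toC_eq0.
have conjNV (z : R[i]) : conjc (- z^-1) = - (conjc z)^-1.
  by rewrite (rmorphN (@conjc R)) (fmorphV (@conjc R)).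
by rewrite ofCK conjNV conjcK invrN invrK opprK toCK.
Qed.

Definition antipodal {R : realType} : rel (S2 R) :=
  fun p q => (q == p) || (q == antipode p).

Lemma antipodal_equiv {R : realType} : equiv_class_of (@antipodal R).
Proof.
split=> [p|p q|q p r]; rewrite /antipodal ?eqxx//.
- by rewrite (eq_sym p q) (eq_sym p) (inv_eq antipodeK).
- by move=> /orP[]/eqP-> /orP[]/eqP->; rewrite ?antipodeK eqxx ?orbT.
Qed.

Canonical antipodal_equivRel (R : realType) :=
  EquivRelPack (@antipodal_equiv R).

Definition RP2 (R : realType) :=
  quotient_topology {eq_quot (@antipodal_equivRel R)}%qT.

HB.instance Definition _ (R : realType) := Topological.on (RP2 R).

(* the class [z] of a finite point z *)
Definition RP2_class {R : realType} (q : R * R) : RP2 R :=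
  (\pi_(RP2 R) (Some q : S2 R))%qT.

Definition sqn {R : realType} (q : R * R) : R := q.1 ^+ 2 + q.2 ^+ 2.

Definition closed_disk {R : realType} : set (R * R) := [set q | sqn q <= 1].

Definition g_can {R : realType} (q v w : R * R) : R :=
  4 * (v.1 * w.1 + v.2 * w.2) / (1 + sqn q) ^+ 2.

(* The integral over RP^2 against dA, computed in the closed disk, which meets
   every antipodal pair once, except on its boundary (a null set). *)
Definition RP2_integral {R : realType} (f : RP2 R -> R) : R :=
  \int[(@lebesgue_measure R \x @lebesgue_measure R)%E]_(q in closed_disk)
    (f (RP2_class q) * (4 / (1 + sqn q) ^+ 2)).

Definition conj_row {R : realType} {n : nat} (Z : 'rV[R[i]]_n) : 'rV[R[i]]_n :=
  map_mx conjc Z.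

Definition dot {R : realType} {n : nat} (Z W : 'rV[R[i]]_n) : R[i] :=
  \sum_(i < n) Z 0 i * W 0 i.

(* The Fubini-Study metric of constant holomorphic sectional curvature 1, in
   homogeneous coordinates: the symmetric real bilinear form at Z != 0 whose
   quadratic form is 4 (|Z|^2 |dZ|^2 - (conj Z, dZ) (Z, conj dZ)) / |Z|^4. *)
Definition fubini_study {R : realType} {n : nat} (Z V W : 'rV[R[i]]_n) : R :=
  complex.Re (4 * (dot Z (conj_row Z) * dot V (conj_row W)
                   - dot (conj_row Z) V * dot Z (conj_row W))
              / dot Z (conj_row Z) ^+ 2).

(* The real differential at q, in the direction v, of a map to C^n. *)
Definition curve_diff {R : realType} {n : nat} (F : R * R -> 'rV[R[i]]_n)
    (q v : R * R) : 'rV[R[i]]_n :=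
  \row_i ('D_v (fun p => complex.Re (F p 0 i)) q
          +i* 'D_v (fun p => complex.Im (F p 0 i)) q).

Definition pullback_fs {R : realType} {n : nat} (F : R * R -> 'rV[R[i]]_n)
    (q v w : R * R) : R :=
  fubini_study (F q) (curve_diff F q v) (curve_diff F q w).

Definition coef_n {R : realType} (m : R) : R :=
  3 * Num.sqrt ((3 * m ^+ 2 - 5) / (m ^+ 2 + 9)).

Definition coef_p {R : realType} (m : R) : R := coef_n m * m / 3.

(* Homogeneous coordinates of Psi_m^5. *)
Definition Psi5 {R : realType} (m : R) (q : R * R) : 'rV[R[i]]_4 :=
  let z := toC q in
  let n := (coef_n m)%:C in
  let p := (coef_p m)%:C in
  \row_(i < 4) [:: 1 + p * z ^+ 2;
                   p * z ^+ 3 + z ^+ 5;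
                   m%:C * z + n * z ^+ 3;
                   - (n * z ^+ 2) - m%:C * z ^+ 4]`_i.

(* h is the conformal factor on RP^2 of the metric induced by Psi_m^5:
   g_ind;m = h g_can.  The four coordinates have no common zero, except for
   m = sqrt 3 at z = i and z = -i, where the curve is only defined after
   clearing the factor 1 + z^2; those two points are left out.  The point at
   infinity needs no separate clause, its class being [0]. *)
Definition conformal_factor {R : realType} (m : R) (h : RP2 R -> R) : Prop :=
  forall q v w : R * R, Psi5 m q != 0 ->
    pullback_fs (Psi5 m) q v w = h (RP2_class q) * g_can q v w.

(* Main.v *)
Require Import Defs.
From mathcomp Require Import all_boot all_order all_algebra.
From mathcomp Require Import complex ring lra.
From mathcomp Require Import all_classical all_reals all_analysis.
From mathcomp Require Import measurable_realfun.
Import Order.TTheory GRing.Theory Num.Theory numFieldNormedType.Exports.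
Local Open Scope classical_set_scope.
Local Open Scope ring_scope.

Set Implicit Arguments.
Unset Strict Implicit.
Unset Printing Implicit Defensive.

(** Write r = |z|^2 and t = Re (z^2).  The relations 3p = mn and
    p^2 + n^2 = 3m^2 - 5 are exactly what makes the squared norm of Psi_m^5
    factor as (1 + r)^3 Q, with Q = 1 + (m^2 - 3) r + r^2 + 2pt.  The induced
    metric is the complex Hessian of the logarithm of this norm, so the factor
    (1 + r)^3 contributes 3 times the canonical metric and the conformal factor
    is h_m = 3 + (1 + r)^2 L with L the mixed derivative of log Q in z and in
    its conjugate.  Against dA this gives the term 3 dA plus 4 L dx dy
    ([conformal_factorE]), and it remains to see that L dx dy tends to pi times
    the Dirac mass at 0.

    For large m, L is close to the radial peak m^2 / (1 + m^2 r)^2, obtained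
    from log Q by keeping only 1 + m^2 r in Q; [peak_approx] bounds the error
    on the disk by a multiple of m / (1 + m^2 r).  Every peak has total mass pi
    on the plane ([peak_integral]), of which only O(1/m^2) lies outside the disk
    ([peak_integral_disk_ge]).  The error m / (1 + m^2 r) is in turn at most
    m^(-1/2) times a sum of peaks of parameters m and sqrt m and a constant
    ([tail_le_peaks]), so that its integral tends to 0: all the estimates rest
    on the single integral of a peak.  Finally a function that is continuous at
    0 and bounded on the disk differs from its value at 0 by at most e + C r
    ([sublinear_modulus]), and r times a peak is again bounded by the same error
    term. *)

(** * Directional derivatives of complex-valued functions *)

Lemma is_derive_linear {R : numFieldType} {V W : normedModType R}
    (f : {linear V -> W}) (q v : V) : is_derive q v f (f v).
Proof.
have cvgf : h^-1 *: (f (h *: v + q) - f q) @[h --> (0 : R)^'] --> f v.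
  apply: (@cvg_trans _ (f v @[h --> (0 : R)^'])); last exact: cvg_cst.
  apply: near_eq_cvg; near=> h.
  rewrite (linearD f) linearZ_LR addrK scalerA mulVf ?scale1r//.
  by near: h; exact: nbhs_dnbhs_neq.
by split; [exact: cvgP cvgf|exact: cvg_lim cvgf].
Unshelve. all: by end_near. Qed.

(** The real and imaginary parts are differentiated separately, as in
    [curve_diff]. *)
Definition has_diff {R : realType} (f : R * R -> R[i]) (q v : R * R) (d : R[i]) :=
  is_derive q v (fun p => complex.Re (f p)) (complex.Re d) /\
  is_derive q v (fun p => complex.Im (f p)) (complex.Im d).

Section has_diff.
Context {R : realType}.
Implicit Types (f g : R * R -> R[i]) (q v : R * R) (c d : R[i]).

Lemma has_diff_eq f q v d d' : has_diff f q v d -> d = d' -> has_diff f q v d'.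
Proof. by move=> ? <-. Qed.

Lemma has_diff_toC q v : has_diff toC q v (toC v).
Proof.
by split; [exact: (is_derive_linear fst)|exact: (is_derive_linear snd)].
Qed.

Lemma has_diff_cst c q v : has_diff (fun=> c) q v 0.
Proof. by split; exact: is_derive_cst. Qed.

Lemma has_diffD f g q v c d : has_diff f q v c -> has_diff g q v d ->
  has_diff (fun p => f p + g p) q v (c + d).
Proof.
move=> [fR fI] [gR gI]; split.
  by rewrite raddfD /=; under eq_fun do rewrite raddfD; exact: is_deriveD.
by rewrite raddfD /=; under eq_fun do rewrite raddfD; exact: is_deriveD.
Qed.

Lemma has_diffN f q v c : has_diff f q v c -> has_diff (fun p => - f p) q v (- c).
Proof.
move=> [fR fI]; split.
  by rewrite raddfN /=; under eq_fun do rewrite raddfN; exact: is_deriveN.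
by rewrite raddfN /=; under eq_fun do rewrite raddfN; exact: is_deriveN.
Qed.

(** The Leibniz rule for the complex product makes the usual rule for the
    derivative of a polynomial in z available, instead of an expansion of each
    coordinate in x and y. *)
Lemma has_diffM f g q v c d : has_diff f q v c -> has_diff g q v d ->
  has_diff (fun p => f p * g p) q v (f q * d + c * g q).
Proof.
have ReM (a b : R[i]) : complex.Re (a * b) =
  complex.Re a * complex.Re b - complex.Im a * complex.Im b by case: a b => ? ? [].
have ImM (a b : R[i]) : complex.Im (a * b) =
  complex.Re a * complex.Im b + complex.Im a * complex.Re b by case: a b => ? ? [].
move=> [fR fI] [gR gI]; split.
  under eq_fun do rewrite ReM.
  apply: is_derive_eq.
  by case: (f q) (g q) c d fR fI gR gI => ? ? [? ?] [? ?] [? ?] /= *;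
    rewrite /GRing.scale /=; ring.
under eq_fun do rewrite ImM.
apply: is_derive_eq.
by case: (f q) (g q) c d fR fI gR gI => ? ? [? ?] [? ?] [? ?] /= *;
    rewrite /GRing.scale /=; ring.
Qed.

Lemma has_diffX f q v c k : has_diff f q v c ->
  has_diff (fun p => f p ^+ k.+1) q v (k.+1%:R * f q ^+ k * c).
Proof.
move=> fc; elim: k => [|k IHk].
  by rewrite expr0 mulr1 mul1r.
have -> : (fun p => f p ^+ k.+2) = (fun p => f p * f p ^+ k.+1).
  by apply/funext => p; rewrite exprS.
apply: has_diff_eq (has_diffM fc IHk) _.
by rewrite -(natr1 k.+1) (exprS _ k); ring.
Qed.

Lemma curve_diffE n (F : R * R -> 'rV[R[i]]_n) (q v : R * R) (D : 'rV[R[i]]_n) :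
  (forall i, has_diff (fun p => F p 0 i) q v (D 0 i)) -> curve_diff F q v = D.
Proof.
move=> FD; apply/rowP => i; rewrite mxE.
by case: (FD i) => dR dI; rewrite !derive_val; case: (D 0 i).
Qed.
End has_diff.

(** * The metric induced by the curve *)

Section coefficients.
Context {R : realType}.
Implicit Types (m : R).

Lemma coef_n_sqr m : 5 <= 3 * m ^+ 2 ->
  coef_n m ^+ 2 * (m ^+ 2 + 9) = 9 * (3 * m ^+ 2 - 5).
Proof.
move=> m5; have m9 : 0 < m ^+ 2 + 9 by have ? := sqr_ge0 m; lra.
rewrite exprMn sqr_sqrtr; last by rewrite divr_ge0 ?subr_ge0// ltW.
by field; rewrite gt_eqF.
Qed.

Lemma coef_pE m : 3 * coef_p m = m * coef_n m.
Proof. by rewrite /coef_p; field. Qed.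

Lemma coef_p_sqr m : 5 <= 3 * m ^+ 2 ->
  coef_p m ^+ 2 + coef_n m ^+ 2 = 3 * m ^+ 2 - 5.
Proof.
move=> /coef_n_sqr nE; apply: (@mulfI _ 9); first by rewrite pnatr_eq0.
rewrite -nE mulrDr (_ : 9 * coef_p m ^+ 2 = (3 * coef_p m) ^+ 2); last by ring.
by rewrite coef_pE; ring.
Qed.

Lemma coef_p_ge0 m : 0 <= m -> 0 <= coef_p m.
Proof. by move=> m0; rewrite divr_ge0// mulr_ge0// mulr_ge0// sqrtr_ge0. Qed.

Lemma coef_p_le m : 0 <= m -> 5 <= 3 * m ^+ 2 -> coef_p m <= 2 * m.
Proof.
move=> m0 m5; have p2 := coef_p_sqr m5; have n2 := sqr_ge0 (coef_n m).
rewrite -(@ler_pXn2r _ 2) ?nnegrE ?coef_p_ge0 ?mulr_ge0//.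
have m2 := sqr_ge0 m; rewrite [leRHS]exprMn.
have -> : 2 ^+ 2 = 4 :> R by ring.
lra.
Qed.

Lemma large_m m : 10 <= m -> [/\ 0 <= m, 5 <= 3 * m ^+ 2 & Num.sqrt (5 / 3) < m].
Proof.
move=> m10; have m5 : 5 <= 3 * m ^+ 2 by rewrite expr2; nra.
split => //; first lra.
rewrite -(@ltr_pXn2r _ 2) ?nnegrE ?sqrtr_ge0//; last lra.
by rewrite sqr_sqrtr; [rewrite expr2; nra|lra].
Qed.

End coefficients.

(** The conjugate of z is treated as an independent variable w: then the
    derivatives in z and in its conjugate become polynomial derivatives in z and
    in w, and the identities below hold in any commutative ring. *)
Section psi5.
Context {K : comPzRingType}.
Implicit Types m n p z w : K.

Definition psi5 m n p z : 'rV[K]_4 :=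
  \row_(i < 4) [:: 1 + p * z ^+ 2;
                   p * z ^+ 3 + z ^+ 5;
                   m * z + n * z ^+ 3;
                   - (n * z ^+ 2) - m * z ^+ 4]`_i.

(** The derivative of [psi5] in z. *)
Definition psi5' m n p z : 'rV[K]_4 :=
  \row_(i < 4) [:: 2 * p * z;
                   3 * p * z ^+ 2 + 5 * z ^+ 4;
                   m + 3 * n * z ^+ 2;
                   - (2 * n * z) - 4 * m * z ^+ 3]`_i.

Definition potential m p z w : K :=
  1 + (m ^+ 2 - 3) * (z * w) + (z * w) ^+ 2 + p * (z ^+ 2 + w ^+ 2).

(** The derivative of [potential] in z; exchanging z and w gives the one in w. *)
Definition potential' m p z w : K :=
  (m ^+ 2 - 3) * w + 2 * (z * w) * w + 2 * p * z.

Lemma map_psi5 (f : {rmorphism K -> K}) m n p z :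
  map_mx f (psi5 m n p z) = psi5 (f m) (f n) (f p) (f z).
Proof.
apply/rowP => i; rewrite !mxE; case: i => -[|[|[|[|//]]]] i /=;
  by rewrite !(rmorphXn, rmorphD, rmorphB, rmorphN, rmorph1, rmorph_nat, rmorphM).
Qed.

Lemma map_psi5' (f : {rmorphism K -> K}) m n p z :
  map_mx f (psi5' m n p z) = psi5' (f m) (f n) (f p) (f z).
Proof.
apply/rowP => i; rewrite !mxE; case: i => -[|[|[|[|//]]]] i /=;
  by rewrite !(rmorphXn, rmorphD, rmorphB, rmorphN, rmorph1, rmorph_nat, rmorphM).
Qed.

Section potential_identities.
Variables (m n p z w : K).
Hypotheses (mnE : m * n = 3 * p) (nnE : n ^+ 2 = 3 * m ^+ 2 - 5 - p ^+ 2).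

(** The next two identities are the derivatives of this one, in z and then in z
    and w. *)
Lemma psi5_dot : \sum_i psi5 m n p z 0 i * psi5 m n p w 0 i
  = (1 + z * w) ^+ 3 * potential m p z w.
Proof.
rewrite !big_ord_recr big_ord0 /= add0r !mxE /= /potential.
by ring: mnE nnE.
Qed.

Lemma psi5'_dot : \sum_i psi5' m n p z 0 i * psi5 m n p w 0 i
  = (1 + z * w) ^+ 2 *
    (3 * w * potential m p z w + (1 + z * w) * potential' m p z w).
Proof.
rewrite !big_ord_recr big_ord0 /= add0r !mxE /= /potential /potential'.
by ring: mnE nnE.
Qed.

Lemma psi5'_dot' : \sum_i psi5' m n p z 0 i * psi5' m n p w 0 i
  = (1 + z * w) * (3 * (1 + 3 * (z * w)) * potential m p z w
      + 3 * (1 + z * w) * (z * potential' m p z w + w * potential' m p w z)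
      + (1 + z * w) ^+ 2 * (m ^+ 2 - 3 + 4 * (z * w))).
Proof.
rewrite !big_ord_recr big_ord0 /= add0r !mxE /= /potential /potential'.
by ring: mnE nnE.
Qed.

(** The left-hand side is Q Q_zw - Q_z Q_w for Q the potential, that is Q^2 times
    the mixed derivative of log Q. *)
Lemma potential_wronskian :
  potential m p z w * (m ^+ 2 - 3 + 4 * (z * w))
  - potential' m p z w * potential' m p w z
  = (m ^+ 2 - 3) * (1 + (z * w) ^+ 2 - p * (z ^+ 2 + w ^+ 2))
    + 4 * (1 - p ^+ 2) * (z * w).
Proof. by rewrite /potential /potential'; ring. Qed.

End potential_identities.
End psi5.

Section conformal_factor.
Local Open Scope complex_scope.
Context {R : realType}.
Implicit Types (m : R) (q v : R * R).

Definition real_potential m q : R :=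
  1 + (m ^+ 2 - 3) * sqn q + sqn q ^+ 2
  + 2 * coef_p m * (q.1 ^+ 2 - q.2 ^+ 2).

Definition log_laplacian_num m q : R :=
  (m ^+ 2 - 3) * (1 + sqn q ^+ 2 - 2 * coef_p m * (q.1 ^+ 2 - q.2 ^+ 2))
  + 4 * (1 - coef_p m ^+ 2) * sqn q.

(** The mixed derivative of log Q in z and its conjugate, a quarter of its
    Laplacian, for Q the [real_potential]. *)
Definition log_laplacian m q : R :=
  log_laplacian_num m q / real_potential m q ^+ 2.

Lemma toC_conj_mul q : toC q * conjc (toC q) = (sqn q)%:C.
Proof.
case: q => x y; rewrite /sqn /toC /=; apply/eqP; rewrite eq_complex /=.
by apply/andP; split; apply/eqP; ring.
Qed.

Lemma toC_conj_sqr q :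
  toC q ^+ 2 + conjc (toC q) ^+ 2 = (2 * (q.1 ^+ 2 - q.2 ^+ 2))%:C.
Proof.
case: q => x y; rewrite /toC /=; apply/eqP; rewrite eq_complex /=.
by apply/andP; split; apply/eqP; ring.
Qed.

Lemma Psi5E m q :
  Psi5 m q = psi5 m%:C (coef_n m)%:C (coef_p m)%:C (toC q).
Proof. by []. Qed.

Lemma curve_diff_Psi5 m q : curve_diff (Psi5 m) q (1, 0) =
  psi5' m%:C (coef_n m)%:C (coef_p m)%:C (toC q).
Proof.
have toCX k : has_diff (fun p => toC p ^+ k.+1) q (1, 0) (k.+1%:R * toC q ^+ k).
  by apply: has_diff_eq (has_diffX k (has_diff_toC q (1, 0))) _; rewrite mulr1.
have ctoCX c k : has_diff (fun p => c * toC p ^+ k.+1) q (1, 0)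
    (c * (k.+1%:R * toC q ^+ k)).
  apply: has_diff_eq (has_diffM (has_diff_cst c q (1, 0)) (toCX k)) _.
  by rewrite mul0r addr0.
apply: curve_diffE => i; under [X in has_diff X]funext do rewrite mxE.
rewrite mxE; case: i => -[|[|[|[|//]]]] i /=.
- apply: has_diff_eq (has_diffD (has_diff_cst 1 q _) (ctoCX _ 1)) _; ring.
- apply: has_diff_eq (has_diffD (ctoCX _ 2) (toCX 4)) _; ring.
- apply: has_diff_eq (has_diffD (ctoCX m%:C 0) (ctoCX _ 2)) _; ring.
- apply: has_diff_eq (has_diffD (has_diffN (ctoCX _ 1)) (has_diffN (ctoCX _ 3))) _.
  ring.
Qed.

Lemma potentialE m q :
  potential m%:C (coef_p m)%:C (toC q) (conjc (toC q)) = (real_potential m q)%:C.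
Proof.
rewrite /potential toC_conj_mul toC_conj_sqr /real_potential.
by rewrite !(rmorphXn, rmorphD, rmorphB, rmorph1, rmorph_nat, rmorphM); ring.
Qed.

Lemma conjcR (x : R) : conjc x%:C = x%:C.
Proof. by rewrite /= oppr0. Qed.

Lemma conj_psi5 (m n p : R) (z : R[i]) :
  conj_row (psi5 m%:C n%:C p%:C z) = psi5 m%:C n%:C p%:C (conjc z).
Proof. by rewrite /conj_row (map_psi5 conjc); congr psi5; exact: conjcR. Qed.

Lemma conj_psi5' (m n p : R) (z : R[i]) :
  conj_row (psi5' m%:C n%:C p%:C z) = psi5' m%:C n%:C p%:C (conjc z).
Proof. by rewrite /conj_row (map_psi5' conjc); congr psi5'; exact: conjcR. Qed.

Lemma sqn_ge0 q : 0 <= sqn q.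
Proof. by rewrite addr_ge0 ?sqr_ge0. Qed.

Lemma fubini_study_quadE n (Z V : 'rV[R[i]]_n) (A B B' C : R[i]) :
    dot Z (conj_row Z) = A -> dot V (conj_row V) = C ->
    dot (conj_row Z) V = B -> dot Z (conj_row V) = B' ->
  fubini_study Z V V = complex.Re (4 * (A * C - B * B') / A ^+ 2).
Proof. by move=> <- <- <- <-. Qed.

Lemma dotC n (Z W : 'rV[R[i]]_n) : dot Z W = dot W Z.
Proof. by apply: eq_bigr => i _; exact: mulrC. Qed.

Lemma coef_mnC m : m%:C * (coef_n m)%:C = 3 * (coef_p m)%:C.
Proof. by rewrite -!(rmorph_nat (real_complex R)) -!rmorphM coef_pE. Qed.

Lemma coef_nnC m : 5 <= 3 * m ^+ 2 ->
  (coef_n m)%:C ^+ 2 = 3 * m%:C ^+ 2 - 5 - (coef_p m)%:C ^+ 2.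
Proof.
move=> m5; rewrite -!(rmorph_nat (real_complex R)) -!rmorphXn -!rmorphM -!rmorphB.
by rewrite -coef_p_sqr// addrAC subrr add0r.
Qed.

Lemma sqnorm_Psi5 m q : 5 <= 3 * m ^+ 2 ->
  dot (Psi5 m q) (conj_row (Psi5 m q)) = ((1 + sqn q) ^+ 3 * real_potential m q)%:C.
Proof.
move=> m5; rewrite Psi5E conj_psi5.
have realM (s Q : R) : ((1 + s) ^+ 3 * Q)%:C = (1 + s%:C) ^+ 3 * Q%:C.
  by rewrite rmorphM rmorphXn rmorphD rmorph1.
by rewrite realM -toC_conj_mul -potentialE; exact: psi5_dot (coef_mnC m) (coef_nnC m5).
Qed.

Lemma Psi5_neq0 m q : 5 <= 3 * m ^+ 2 -> real_potential m q != 0 -> Psi5 m q != 0.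
Proof.
move=> m5; apply: contra_neq => Psi0; have := sqnorm_Psi5 q m5.
rewrite Psi0 /dot big1 => [|i _]; last by rewrite mxE mul0r.
move=> /esym/eqP; rewrite fmorph_eq0 mulf_eq0 expf_eq0/=.
by rewrite gt_eqF ?ltr_wpDr ?sqn_ge0//= => /eqP.
Qed.

(** The pullback form is conformal, so its value on the vector (1, 0) is enough;
    in that direction the differential of the curve is its derivative in z.
    With A = (1 + r)^3 Q the squared norm, the numerator A A_zw - A_z A_w of the
    metric is (1 + r)^4 (3 Q^2 + (1 + r)^2 (Q Q_zw - Q_z Q_w)). *)
Lemma pullback_fs_Psi5 m q : 5 <= 3 * m ^+ 2 -> real_potential m q != 0 ->
  pullback_fs (Psi5 m) q (1, 0) (1, 0)
  = 4 * (3 / (1 + sqn q) ^+ 2 + log_laplacian m q).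
Proof.
move=> m5 Q0.
have mnE := coef_mnC m; have nnE := coef_nnC m5.
pose z := toC q; pose w := conjc z.
pose Qc := (real_potential m q)%:C; pose rc := (sqn q)%:C.
pose P := potential' m%:C (coef_p m)%:C z w.
pose P' := potential' m%:C (coef_p m)%:C w z.
have zw : z * w = rc by exact: toC_conj_mul.
have wz : w * z = rc by rewrite mulrC.
have zwQ : potential m%:C (coef_p m)%:C z w = Qc by exact: potentialE.
have wzQ : potential m%:C (coef_p m)%:C w z = Qc.
  by rewrite -zwQ /potential wz zw; ring.
rewrite /pullback_fs curve_diff_Psi5 Psi5E.
rewrite (fubini_study_quadE
  (A := (1 + rc) ^+ 3 * Qc)
  (C := (1 + rc) * (3 * (1 + 3 * rc) * Qc + 3 * (1 + rc) * (z * P + w * P')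
          + (1 + rc) ^+ 2 * (m%:C ^+ 2 - 3 + 4 * rc)))
  (B := (1 + rc) ^+ 2 * (3 * w * Qc + (1 + rc) * P))
  (B' := (1 + rc) ^+ 2 * (3 * z * Qc + (1 + rc) * P'))); first last.
- by rewrite conj_psi5' dotC -wz -wzQ; exact: psi5'_dot.
- by rewrite conj_psi5 dotC -zw -zwQ; exact: psi5'_dot.
- by rewrite conj_psi5' -zw -zwQ; exact: psi5'_dot'.
- by rewrite conj_psi5 -zw -zwQ; exact: psi5_dot.
have Nc : (log_laplacian_num m q)%:C = Qc * (m%:C ^+ 2 - 3 + 4 * rc) - P * P'.
  have := potential_wronskian m%:C (coef_p m)%:C z w.
  rewrite zwQ -/P -/P' zw toC_conj_sqr => ->; rewrite /log_laplacian_num /rc.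
  move: (coef_p m) (sqn q) (q.1 ^+ 2 - q.2 ^+ 2) => p s t.
  by rewrite !(rmorphXn, rmorphD, rmorphB, rmorph1, rmorph_nat, rmorphM); ring.
rewrite [X in complex.Re X](_ : _ =
    (4 * (3 / (1 + sqn q) ^+ 2 + log_laplacian m q))%:C) //.
have Q0' : Qc != 0 by rewrite fmorph_eq0.
have r0' : 1 + rc != 0.
  rewrite -(rmorph1 (real_complex R)) -rmorphD fmorph_eq0.
  by rewrite gt_eqF// ltr_wpDr ?sqn_ge0.
have -> : (4 * (3 / (1 + sqn q) ^+ 2 + log_laplacian m q))%:C
    = 4 * (3 / (1 + rc) ^+ 2 + (log_laplacian_num m q)%:C / Qc ^+ 2).
  rewrite /log_laplacian /rc /Qc.
  move: (log_laplacian_num m q) (real_potential m q) (sqn q) => N Q s.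
  by rewrite !(fmorphV, rmorphXn, rmorphD, rmorph1, rmorph_nat, rmorphM).
rewrite {}Nc.
rewrite -zw in r0' *.
field; last by rewrite Q0' r0'.
Qed.

Lemma norm_sqrB_le q : `|q.1 ^+ 2 - q.2 ^+ 2| <= sqn q.
Proof.
rewrite /sqn ler_norml; have := sqr_ge0 q.1; have := sqr_ge0 q.2.
by move=> ? ?; apply/andP; split; lra.
Qed.

Lemma real_potential_gt0 m q : 10 <= m -> 0 < real_potential m q.
Proof.
move=> m10; have [m0 m5 _] := large_m m10.
have p0 := coef_p_ge0 m0; have pm := coef_p_le m0 m5.
rewrite /real_potential; have := norm_sqrB_le q; have := sqn_ge0 q.
move: (sqn q) (_ - _ : R) => s d; set p := coef_p m in p0 pm *.
rewrite ler_norml => s0 /andP[ds sd].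
have pd : - (2 * m * s) <= p * d.
  have : `|p * d| <= 2 * m * s.
    by rewrite normrM ger0_norm// ler_pM// ler_norml ds sd.
  by rewrite ler_norml => /andP[].
have ms : 10 * (m * s) <= m ^+ 2 * s.
  by rewrite mulrA ler_wpM2r// expr2 ler_wpM2r.
have ms0 : 10 * s <= m * s by rewrite ler_wpM2r.
have s2 := sqr_ge0 s.
rewrite (_ : _ + _ = 1 + (m ^+ 2 * s - 3 * s) + s ^+ 2 + 2 * (p * d)); last by ring.
lra.
Qed.

(** The factor 4 / (1 + r)^2 is the density of dA: this is the integrand on the
    disk, where the first term yields 3 dA. *)
Lemma conformal_factorE m (h : RP2 R -> R) q : 10 <= m -> conformal_factor m h ->
  h (RP2_class q) * (4 / (1 + sqn q) ^+ 2)
  = 4 * (3 / (1 + sqn q) ^+ 2 + log_laplacian m q).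
Proof.
move=> m10 hh; have [m0 m5 _] := large_m m10.
have Q0 : real_potential m q != 0 by rewrite gt_eqF ?real_potential_gt0.
rewrite -(pullback_fs_Psi5 m5 Q0) hh; last exact: Psi5_neq0.
by rewrite /g_can /= mulr1 mul0r addr0 mulr1.
Qed.

End conformal_factor.

(** * Comparison with a radial peak *)

Section peak.
Context {R : realType}.
Implicit Types (m p s t : R).

(** The mixed derivative of log (1 + m^2 |z|^2), where s stands for |z|^2. *)
Definition peak m s : R := m ^+ 2 / (1 + m ^+ 2 * s) ^+ 2.

Lemma peak_ge0 t s : 0 <= peak t s.
Proof. by rewrite divr_ge0 ?sqr_ge0. Qed.

(** With P = 1 + m^2 s, both |Q - P| <= 5 P / m and |N - m^2| <= 8 m P, which
    perturbs m^2 / P^2 by O(m / P).  The error need not be small relative to the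
    peak: at s = 1 it can be of order 1 / m while the peak is of order 1 / m^2. *)
Lemma peak_approx m p s t : 10 <= m -> 0 <= p -> p <= 2 * m ->
    0 <= s -> s <= 1 -> `|t| <= s ->
  let Q := 1 + (m ^+ 2 - 3) * s + s ^+ 2 + 2 * p * t in
  let N := (m ^+ 2 - 3) * (1 + s ^+ 2 - 2 * p * t) + 4 * (1 - p ^+ 2) * s in
  (`|N / Q ^+ 2 - peak m s| <= 82 * (m / (1 + m ^+ 2 * s)) : Prop).
Proof.
move=> m10 p0 pm s0 s1; rewrite ler_norml => /andP[ts st] Q N.
set P := 1 + m ^+ 2 * s.
have m0 : 0 < m by lra.
have ms0 : 0 <= m * s by nra.
have s2 : 0 <= s ^+ 2 <= s by rewrite sqr_ge0 expr2 ler_piMl.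
have pt : `|p * t| <= 2 * m * s.
  by rewrite normrM ger0_norm// ler_pM// ler_norml ts st.
have P1 : 1 <= P by rewrite /P; nra.
have mP : m * (m * s) <= P by rewrite /P; nra.
(* As P >= m^2 s, the difference is at most 5 P / m, hence P / 2 for m >= 10. *)
have QP : `|Q - P| <= 5 * (m * s).
  rewrite (_ : Q - P = s ^+ 2 - 3 * s + 2 * (p * t)); last by rewrite /Q /P; ring.
  move: pt; rewrite !ler_norml => /andP[? ?]; apply/andP; split; nra.
have QP2 : `|Q - P| <= 2^-1 * P.
  by apply: (le_trans QP); nra.
have [QP3 QP4] : 2^-1 * P <= Q /\ Q <= 3/2 * P.
  by move: QP2; rewrite ler_norml => /andP[? ?]; split; lra.
have p2 : 0 <= p ^+ 2 * s <= 4 * m ^+ 2 * s.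
  apply/andP; split; first by rewrite mulr_ge0// sqr_ge0.
  by rewrite ler_wpM2r// !expr2; nra.
(* The terms of order m^2 s or less are absorbed into m^3 s by 10 <= m. *)
have NP : `|N - m ^+ 2| <= 8 * m * P.
  have -> : N - m ^+ 2 = - 3 + (m ^+ 2 - 3) * s ^+ 2 - 2 * (m ^+ 2 - 3) * (p * t)
                       + 4 * s - 4 * (p ^+ 2 * s) by rewrite /N; ring.
  have h1 : 0 <= (m ^+ 2 - 3) * s ^+ 2 <= m ^+ 2 * s.
    have m3 : 0 <= m ^+ 2 - 3 by rewrite expr2; nra.
    case/andP: s2 => s2 ss; rewrite mulr_ge0//=.
    by apply: ler_pM => //; lra.
  have h2 : `|(m ^+ 2 - 3) * (p * t)| <= m ^+ 2 * (2 * m * s).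
    by rewrite normrM; apply: ler_pM => //; rewrite ger0_norm; nra.
  have h3 : m ^+ 2 * s * 10 <= m * (m ^+ 2 * s).
    by rewrite mulrC ler_wpM2r// mulr_ge0// sqr_ge0.
  have h4 : 0 <= m ^+ 2 * s by rewrite mulr_ge0// sqr_ge0.
  have -> : 8 * m * P = 8 * m + 8 * (m * (m ^+ 2 * s)) by rewrite /P; ring.
  have h5 : m ^+ 2 * (2 * m * s) = 2 * (m * (m ^+ 2 * s)) by ring.
  rewrite h5 in h2.
  move: h1 p2 h2; rewrite !ler_norml => /andP[? ?] /andP[? ?] /andP[? ?].
  by apply/andP; split; lra.
have P0 : 0 < P by lra.
have Q0 : 0 < Q by lra.
have -> : N / Q ^+ 2 - peak m s =
    (N - m ^+ 2) / Q ^+ 2 - m ^+ 2 * (Q - P) * (Q + P) / (P ^+ 2 * Q ^+ 2).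
  by rewrite /peak -/P; field; rewrite !gt_eqF.
have iQ : (Q ^+ 2)^-1 <= 4 / P ^+ 2.
  rewrite -[leLHS]mul1r ler_pdivlMr ?ler_pdivrMl ?exprn_gt0//.
  by rewrite mul1r ler_pdivrMl ?exprn_gt0//; rewrite !expr2; nra.
rewrite (le_trans (ler_normB _ _))//.
have n1 : `|(N - m ^+ 2) / Q ^+ 2| <= 32 * (m / P).
  rewrite normrM [X in _ * X]ger0_norm ?invr_ge0 ?sqr_ge0//.
  apply: (le_trans (ler_pM _ _ NP iQ)); rewrite ?invr_ge0 ?sqr_ge0//.
  rewrite [leLHS](_ : _ = 32 * (m / P))//; by field; rewrite gt_eqF.
have n2 : `|m ^+ 2 * (Q - P) * (Q + P) / (P ^+ 2 * Q ^+ 2)| <= 50 * (m / P).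
  have -> : m ^+ 2 * (Q - P) * (Q + P) / (P ^+ 2 * Q ^+ 2)
    = (m ^+ 2 * (Q - P)) * ((Q + P) / P ^+ 2 / Q ^+ 2).
    by field; rewrite !gt_eqF.
  have a1 : `|m ^+ 2 * (Q - P)| <= 5 * (m * P).
    rewrite normrM ger0_norm ?sqr_ge0//.
    apply: (@le_trans _ _ (m ^+ 2 * (5 * (m * s)))).
      by rewrite ler_wpM2l ?sqr_ge0.
    rewrite (_ : _ * _ = m * 5 * (m * (m * s))); last by ring.
    rewrite (_ : 5 * _ = m * 5 * P); last by ring.
    by rewrite ler_wpM2l//; lra.
  have a2 : `|(Q + P) / P ^+ 2 / Q ^+ 2| <= 10 / P ^+ 3.
    rewrite ger0_norm; last by rewrite !mulr_ge0 ?invr_ge0 ?sqr_ge0//; lra.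
    apply: (@le_trans _ _ (5 / 2 * P / P ^+ 2 * (4 / P ^+ 2))).
      apply: ler_pM => //; rewrite ?invr_ge0 ?sqr_ge0//.
        by rewrite mulr_ge0 ?invr_ge0 ?sqr_ge0//; lra.
      by rewrite ler_wpM2r ?invr_ge0 ?sqr_ge0//; lra.
    by rewrite le_eqVlt; apply/orP; left; apply/eqP; field; rewrite gt_eqF.
  rewrite normrM; apply: (le_trans (ler_pM _ _ a1 a2)) => //.
  have -> : 5 * (m * P) * (10 / P ^+ 3) = 50 * (m / P) * P^-1.
    by field; rewrite gt_eqF.
  rewrite ler_piMr ?invf_le1// mulr_ge0// divr_ge0//; lra.
have mP0 : 0 <= m / P by rewrite divr_ge0; lra.
by move: n1 n2; lra.
Qed.

(** Away from 0 the error term m / (1 + m^2 s), with m = t^2, decreases more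
    slowly than the peak of parameter m, and its mass on the disk is of order
    (log m) / m.  It is cut at s = 1 / m: below, it is controlled by the
    geometric mean of the peaks of parameters m and sqrt m, above, by that of
    the peak of parameter sqrt m and 1. *)
Lemma tail_le_peaks t s : 1 <= t -> 0 <= s ->
  t ^+ 2 / (1 + (t ^+ 2) ^+ 2 * s)
    <= t^-1 * (peak (t ^+ 2) s + 2 * peak t s + 1).
Proof.
move=> t1 s0; rewrite /peak; set A := 1 + _ * s; set B := 1 + t ^+ 2 * s.
have t0 : 0 < t by lra.
have ts0 : 0 <= t ^+ 2 * s by rewrite mulr_ge0// sqr_ge0.
have tts0 : 0 <= (t ^+ 2) ^+ 2 * s by rewrite mulr_ge0// sqr_ge0.
have A0 : 0 < A by rewrite /A; lra.
have B0 : 0 < B by rewrite /B; lra.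
rewrite ler_pdivlMl//.
have amgm (x y : R) : 2 * (x * y) <= x ^+ 2 + y ^+ 2.
  by have := sqr_ge0 (x - y); rewrite sqrrB => ?; lra.
have -> : (t ^+ 2) ^+ 2 / A ^+ 2 = (t ^+ 2 / A) ^+ 2 by rewrite !expr_div_n.
have -> : t ^+ 2 / B ^+ 2 = (t / B) ^+ 2 by rewrite !expr_div_n.
have K1 := amgm (t ^+ 2 / A) (t / B).
have K2 := amgm (t / B) 1.
have K0 := sqr_ge0 (t / B).
have K3 := sqr_ge0 (t ^+ 2 / A).
rewrite expr1n mulr1 in K2.
have [ts1|ts1] := leP (t ^+ 2 * s) 1.
  have h : t * (t ^+ 2 / A) <= 2 * (t ^+ 2 / A * (t / B)).
    rewrite (_ : 2 * _ = t * (t ^+ 2 / A) * (2 / B)); last by field; rewrite !gt_eqF.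
    apply: ler_peMr; first by rewrite mulr_ge0 ?divr_ge0 ?sqr_ge0// ltW.
    by rewrite ler_pdivlMr// mul1r /B; lra.
  lra.
have h : t * (t ^+ 2 / A) <= 2 * (t / B).
  have -> : t * (t ^+ 2 / A) = t ^+ 3 / A by field; rewrite gt_eqF.
  have -> : 2 * (t / B) = 2 * t / B by field; rewrite gt_eqF.
  rewrite ler_pdivrMr// mulrAC ler_pdivlMr//.
  rewrite [leLHS](_ : _ = t * (t ^+ 2 + (t ^+ 2) ^+ 2 * s)); last by rewrite /B; ring.
  rewrite [leRHS](_ : _ = t * (2 + 2 * ((t ^+ 2) ^+ 2 * s))); last by rewrite /A; ring.
  rewrite ler_pM2l// expr2 -mulrA; have := sqr_ge0 t; nra.
lra.
Qed.

End peak.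

(** * Integrals over the plane *)

Section plane_measurability.
Context {R : realType}.

(** The open boxes with rational corners form a countable base of the plane. *)
Lemma open_measurable_plane (U : set (R * R)) : open U -> measurable U.
Proof.
move=> oU.
pose box (i : rat * rat * (rat * rat)) : set (R * R) :=
  `](ratr i.1.1), (ratr i.1.2)[ `*` `](ratr i.2.1), (ratr i.2.2)[.
pose B i := if pselect (box i `<=` U) then box i else set0.
have -> : U = \bigcup_i B i.
  apply/seteqP; split=> [[x y] Uxy|q [i _]]; last first.
    by rewrite /B; case: pselect => // iU /iU.
  have : nbhs (x, y) U by exact: open_nbhs_nbhs.
  move=> /nbhs_ballP [e /= e0 eU].
  have e2 : 0 < e / 2 by rewrite divr_gt0.
  have bx (z : R) : exists2 ab : rat * rat, (ratr ab.1 < z < ratr ab.2) &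
      forall z', ratr ab.1 < z' < ratr ab.2 -> ball z e z'.
    have /rat_in_itvoo[a] : z - e / 2 < z by rewrite ltrBlDr ltrDl.
    have /rat_in_itvoo[b] : z < z + e / 2 by rewrite ltrDl.
    rewrite !in_itv/= => /andP[zb be] /andP[ea az].
    exists (a, b) => /=; first by rewrite az.
    move=> z' /andP[az' zb']; rewrite /ball/= ltr_distlC; apply/andP; split; lra.
  have [a ax aball] := bx x; have [b bx' bball] := bx y.
  exists (a, b) => //; rewrite /B; case: pselect => [?|[]].
    by split; rewrite /= in_itv.
  move=> [x' y'] [/=]; rewrite !in_itv/= => x'a y'b; apply: eU.
  by split; [exact: aball|exact: bball].
apply: countable_bigcupT_measurable; first exact: countableP.
move=> i; rewrite /B; case: pselect => //= _.
exact: measurableX.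
Qed.

Lemma continuous_measurable_plane (f : R * R -> R) :
  continuous f -> measurable_fun setT f.
Proof.
move=> /continuousP cf; apply: (measurability _ (RGenOpens.measurableE R)).
move=> _ [_ [a [b ->] <-]]; rewrite setTI; apply: open_measurable_plane.
exact/cf/interval_open.
Qed.

End plane_measurability.

Section peak_integral.
Context {R : realType}.
Notation mu := (@lebesgue_measure R).

Lemma ge0_even_FTC (f F : R -> R) (l : R) :
  (forall x, 0 <= f x) -> (forall x, f (- x) = f x) -> continuous f ->
  (forall x : R, is_derive x 1 F (f x)) -> F 0 = 0 -> F x @[x --> +oo] --> l ->
  (\int[mu]_x (f x)%:E = (2 * l)%:E)%E.
Proof.
move=> f0 fN cf dF F0 Fl.
rewrite ge0_symfun_integralT//; last by move=> x /=; rewrite fN.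
rewrite -set_itvcy (@ge0_continuous_FTC2y _ f F 0 l)//.
- by rewrite F0 sube0 -EFinM.
- exact: continuous_subspaceT.
- apply: cvg_at_right_filter; apply: differentiable_continuous.
  by apply/derivable1_diffP; exact: ex_derive.
- by move=> x _; rewrite derive1E derive_val.
Qed.

Lemma cvg_atan_scale (c : R) : 0 < c -> atan (c * x) @[x --> +oo] --> pi / 2.
Proof.
move=> c0.
have cy : (fun x => c * x) x @[x --> +oo] --> +oo.
  apply/cvgryPge => A; near=> x.
  by rewrite -ler_pdivrMl//; near: x; apply: nbhs_pinfty_ge; rewrite num_real.
exact: (cvg_comp (fun x => c * x) atan cy (@cvgy_atan R)).
Unshelve. all: by end_near.
Qed.

Lemma is_derive_atan_scale (c x : R) :
  is_derive x 1 (fun x => atan (c * x)) (c / (1 + (c * x) ^+ 2)).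
Proof.
have dc : is_derive x 1 (fun x => c * x) c.
  have := @is_deriveM _ _ (cst c) id x 1 0 1 _ _.
  by rewrite /GRing.scale /= mulr1 mulr0 addr0; exact.
by rewrite mulrC; exact: (is_derive1_comp (f := atan) (g := fun x => c * x)).
Qed.

Lemma cos_atan_sqr (x : R) : cos (atan x) ^+ 2 = (1 + x ^+ 2)^-1.
Proof.
by rewrite cos_atan exprVn sqr_sqrtr// addr_ge0// sqr_ge0.
Qed.

(** The substitution c y = tan a turns the integrand into a multiple of
    cos^2 a, so that a + sin a cos a with a = atan (c y) is proportional to a
    primitive. *)
Lemma inner_integral (k c : R) : 0 < k -> 0 < c ->
  (\int[mu]_y (k / (1 + (c * y) ^+ 2) ^+ 2)%:E = (k * pi / (2 * c))%:E)%E.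
Proof.
move=> k0 c0.
pose F y := k / (2 * c) * (atan (c * y) + sin (atan (c * y)) * cos (atan (c * y))).
have -> : k * pi / (2 * c) =
    2 * (k / (2 * c) * (pi / 2 + sin (pi / 2) * cos (pi / 2))).
  by rewrite cos_pihalf mulr0 addr0; field; rewrite gt_eqF.
apply: (@ge0_even_FTC _ F).
- by move=> y; rewrite divr_ge0 ?sqr_ge0 ?ltW.
- by move=> y; rewrite mulrN sqrrN.
- move=> y; have pos : (1 + (c * y) ^+ 2) ^+ 2 != 0.
    by rewrite expf_neq0// gt_eqF// ltr_pwDl ?sqr_ge0.
  apply: cvgM; first exact: cvg_cst.
  apply: cvgV => //.
  apply: (@continuous_comp _ _ _ (fun y => 1 + (c * y) ^+ 2) (fun z => z ^+ 2));
    last exact: exprn_continuous.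
  apply: cvgD; first exact: cvg_cst.
  apply: (@continuous_comp _ _ _ (fun y => c * y) (fun z => z ^+ 2));
    last exact: exprn_continuous.
  exact: mulrl_continuous.
- move=> y; rewrite /F.
  have dA := is_derive_atan_scale c y.
  have dS : is_derive y 1 (fun y => sin (atan (c * y)))
      (cos (atan (c * y)) * (c / (1 + (c * y) ^+ 2))).
    exact: (is_derive1_comp (f := sin)).
  have dC : is_derive y 1 (fun y => cos (atan (c * y)))
      (- sin (atan (c * y)) * (c / (1 + (c * y) ^+ 2))).
    exact: (is_derive1_comp (f := cos)).
  apply: is_derive_eq; rewrite /GRing.scale /=.
  have := cos_atan_sqr (c * y); have := cos2Dsin2 (atan (c * y)).
  move: (cos _) (sin _) => C S CS CC.
  have D0 : 1 + (c * y) ^+ 2 != 0 by rewrite gt_eqF// ltr_pwDl ?sqr_ge0.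
  move: (1 + (c * y) ^+ 2) D0 CC => D D0 CC.
  have SS : S ^+ 2 = 1 - C ^+ 2 by rewrite -CS; ring.
  transitivity (k / 2 * (1 + C ^+ 2 - S ^+ 2) / D).
    by field; rewrite D0 gt_eqF.
  by rewrite SS CC; field.
- by rewrite /F mulr0 atan0 sin0 mul0r addr0 mulr0.
- have A := cvg_atan_scale c0.
  apply: cvgM; first exact: cvg_cst.
  apply: cvgD => //; apply: cvgM.
    by apply: cvg_comp A _; exact: continuous_sin.
  by apply: cvg_comp A _; exact: continuous_cos.
Qed.

(** As cos (atan u) = (1 + u^2)^(-1/2), the integrand is a multiple of the
    derivative of sin (atan (t x)). *)
Lemma outer_integral (t : R) : 0 < t ->
  (\int[mu]_x (t * pi / 2 * cos (atan (t * x)) / (1 + (t * x) ^+ 2))%:E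
   = (pi : R)%:E)%E.
Proof.
move=> t0.
pose F x : R := pi / 2 * sin (atan (t * x)).
rewrite [in RHS](_ : pi = 2 * (pi / 2 * sin (pi / 2))); last first.
  by rewrite sin_pihalf; field.
have pos (x : R) : 1 + (t * x) ^+ 2 != 0.
  by rewrite gt_eqF// ltr_pwDl ?sqr_ge0.
apply: (@ge0_even_FTC _ F).
- move=> x; have C0 : 0 <= cos (atan (t * x)).
    by rewrite cos_atan invr_ge0 sqrtr_ge0.
  rewrite !mulr_ge0 ?pi_ge0 ?invr_ge0//; first exact: ltW.
  by rewrite addr_ge0 ?sqr_ge0.
- by move=> x; rewrite mulrN sqrrN atanN cosN.
- move=> x; apply: cvgM; last first.
    apply: cvgV => //; apply: cvgD; first exact: cvg_cst.
    apply: (@continuous_comp _ _ _ (fun y => t * y) (fun z => z ^+ 2));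
      last exact: exprn_continuous.
    exact: mulrl_continuous.
  apply: cvgM; first exact: cvg_cst.
  apply: (@continuous_comp _ _ _ (fun y => atan (t * y)) cos);
    last exact: continuous_cos.
  apply: (@continuous_comp _ _ _ (fun y => t * y) atan);
    last exact: continuous_atan.
  exact: mulrl_continuous.
- move=> x; rewrite /F.
  have dA := is_derive_atan_scale t x.
  have dS : is_derive x 1 (fun x => sin (atan (t * x)))
      (cos (atan (t * x)) * (t / (1 + (t * x) ^+ 2))).
    exact: (is_derive1_comp (f := sin)).
  by apply: is_derive_eq; rewrite /GRing.scale /=; field.
- by rewrite /F mulr0 atan0 sin0 mulr0.
- apply: cvgM; first exact: cvg_cst.
  apply: (cvg_comp (fun x => atan (t * x)) sin (cvg_atan_scale t0)).
  exact: continuous_sin.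
Qed.

Lemma continuous_sqn : continuous (@sqn R).
Proof.
move=> q; apply: cvgD.
  apply: (@continuous_comp _ _ _ fst (fun z : R => z ^+ 2));
    [exact: cvg_fst|exact: exprn_continuous].
apply: (@continuous_comp _ _ _ snd (fun z : R => z ^+ 2));
  [exact: cvg_snd|exact: exprn_continuous].
Qed.

Lemma continuous_peak (t : R) : continuous (fun q : R * R => peak t (sqn q)).
Proof.
move=> q; apply: cvgM; first exact: cvg_cst.
apply: cvgV.
  by rewrite expf_neq0// gt_eqF// ltr_pwDl// mulr_ge0 ?sqr_ge0 ?sqn_ge0.
apply: (@continuous_comp _ _ _ (fun q => 1 + t ^+ 2 * sqn q) (fun z => z ^+ 2));
  last exact: exprn_continuous.
apply: cvgD; first exact: cvg_cst.
by apply: cvgM; [exact: cvg_cst|exact: continuous_sqn].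
Qed.

(** Integrating first in y: with C = cos (atan (t x)), so that
    C^-2 = 1 + t^2 x^2, the slice at x is
    t^2 C^4 / (1 + (t C y)^2)^2. *)
Lemma peak_integral (t : R) : 0 < t ->
  (\int[mu \x mu]_q (peak t (sqn q))%:E = (pi : R)%:E)%E.
Proof.
move=> t0; rewrite fubini_tonelli1; last 2 first.
- by apply/measurable_EFinP; apply: continuous_measurable_plane; exact: continuous_peak.
- by move=> q; rewrite lee_fin peak_ge0.
rewrite -(outer_integral t0); apply: eq_integral => x _.
rewrite /fubini_F /peak /sqn /=.
set C := cos (atan (t * x)).
have CC : C ^+ 2 = (1 + (t * x) ^+ 2)^-1 by exact: cos_atan_sqr.
have C0 : 0 < C.
  by rewrite /C cos_atan invr_gt0 sqrtr_gt0 ltr_pwDl ?sqr_ge0.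
have D0 : 0 < 1 + (t * x) ^+ 2 by rewrite ltr_pwDl ?sqr_ge0.
have k0 : 0 < t ^+ 2 * C ^+ 4 by rewrite mulr_gt0 ?exprn_gt0.
transitivity (\int[mu]_y (t ^+ 2 * C ^+ 4 / (1 + (t * C * y) ^+ 2) ^+ 2)%:E)%E.
  apply: eq_integral => y _; congr EFin.
  rewrite (_ : C ^+ 4 = (C ^+ 2) ^+ 2); last by ring.
  rewrite (_ : (t * C * y) ^+ 2 = C ^+ 2 * (t * y) ^+ 2); last by ring.
  rewrite CC.
  rewrite (_ : 1 + t ^+ 2 * _ = 1 + (t * x) ^+ 2 + (t * y) ^+ 2); last by ring.
  have y0 := sqr_ge0 (t * y).
  move: (1 + (t * x) ^+ 2) D0 ((t * y) ^+ 2) y0 => D D0 Y Y0.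
  by field; rewrite !gt_eqF//; lra.
rewrite inner_integral ?mulr_gt0//; congr EFin.
rewrite -[_ / (1 + _)]/(_ * _) -CC; field.
by rewrite !gt_eqF.
Qed.

End peak_integral.

(** * Integrals over the disk *)

Section disk.
Context {R : realType}.
Notation mu := (@lebesgue_measure R).
Notation mu2 := (mu \x mu)%E.
Notation D := (@closed_disk R).
Implicit Types (f g : R * R -> R) (q : R * R) (m t : R).

Lemma disk_sub_square : D `<=` `[-1, 1] `*` `[-1, 1].
Proof.
move=> [x y]; rewrite /closed_disk /sqn /= => xy.
have x2 := sqr_ge0 x; have y2 := sqr_ge0 y.
by split; rewrite /= in_itv/=; apply/andP; split; nra.
Qed.

Lemma measurable_disk : measurable D.
Proof.
have := @continuous_measurable_plane R _ (@continuous_sqn R) measurableT.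
move=> /(_ `]-oo, 1]%classic (measurable_itv _)); rewrite setTI.
by rewrite (_ : sqn @^-1` _ = D).
Qed.

Lemma square_measure : mu2 (`[-1, 1] `*` `[-1, 1]) = 4%:E.
Proof.
rewrite product_measure1E//= lebesgue_measure_itv/= lte_fin ifT; last by lra.
by rewrite -EFinB -EFinM; congr EFin; ring.
Qed.

Lemma disk_measure_le : (mu2 D <= 4%:E)%E.
Proof.
rewrite -square_measure; apply: le_measure; rewrite ?inE.
- exact: measurable_disk.
- exact: measurableX.
- exact: disk_sub_square.
Qed.

Lemma continuous_disk_bounded f : continuous f ->
  exists2 M, 0 <= M & forall q, D q -> `|f q| <= M.
Proof.
move=> cf; pose A : set (R * R) := `[-1, 1] `*` `[-1, 1].
have cA : compact A by apply: compact_setX; exact: segment_compact.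
have [||c _ cmax] := @compact_EVT_max _ _ (fun q => `|f q|) A _ cA.
- by exists 0; split; rewrite /= in_itv/=; lra.
- apply: continuous_subspaceT => q.
  by apply: (@continuous_comp _ _ _ f Num.norm); [exact: cf|exact: norm_continuous].
- exists `|f c| => // q /disk_sub_square Aq; apply: cmax; exact: mem_set.
Qed.

Lemma integrable_disk f : continuous f -> mu2.-integrable D (EFin \o f).
Proof.
move=> cf; apply: measurable_bounded_integrable.
- exact: measurable_disk.
- by apply: le_lt_trans disk_measure_le _; rewrite ltry.
- by apply: measurable_funTS; exact: continuous_measurable_plane.
- have [M M0 fM] := continuous_disk_bounded cf.
  by exists M; split; rewrite ?num_real// => x Mx q /fM /le_trans; apply; exact: ltW.
Qed.

Lemma integrable_peak t : 0 < t ->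
  mu2.-integrable setT (EFin \o (fun q => peak t (sqn q))).
Proof.
move=> t0; apply/integrableP; split.
  by apply/measurable_EFinP; apply: continuous_measurable_plane; exact: continuous_peak.
apply: (@le_lt_trans _ _ (pi : R)%:E); last by rewrite ltry.
rewrite -(peak_integral t0) le_eqVlt; apply/orP; left; apply/eqP.
by apply: eq_integral => q _ /=; rewrite ger0_norm ?peak_ge0.
Qed.

Lemma peak_integral_disk t : 0 < t ->
  \int[mu2]_(q in D) peak t (sqn q) + \int[mu2]_(q in ~` D) peak t (sqn q) = pi.
Proof.
move=> t0; rewrite -Rintegral_setU.
- by rewrite setUv /Rintegral peak_integral.
- exact: measurable_disk.
- exact: measurableC measurable_disk.
- by rewrite setUv; exact: integrable_peak.
- exact/disj_setPCl.
Qed.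

Lemma peak_integral_disk_le t : 0 < t ->
  \int[mu2]_(q in D) peak t (sqn q) <= pi.
Proof.
move=> t0; rewrite -(peak_integral_disk t0) lerDl.
by apply: Rintegral_ge0 => q _; exact: peak_ge0.
Qed.

(** Where 1 <= s, the peak of parameter t is at most 4 / t^2 times the peak of
    parameter 1, whose total mass is also pi. *)
Lemma peak_integral_disk_ge t : 0 < t ->
  pi - 4 * pi / t ^+ 2 <= \int[mu2]_(q in D) peak t (sqn q).
Proof.
move=> t0; have tE := peak_integral_disk t0.
suff : \int[mu2]_(q in ~` D) peak t (sqn q) <= 4 * pi / t ^+ 2 by lra.
have mDC : measurable (~` D) by exact: measurableC measurable_disk.
have iDC s : 0 < s -> mu2.-integrable (~` D) (EFin \o (fun q => peak s (sqn q))).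
  by move=> s0; apply: integrableS (integrable_peak s0).
apply: (@le_trans _ _ (\int[mu2]_(q in ~` D) (4 / t ^+ 2 * peak 1 (sqn q)))).
  apply: le_Rintegral => //; first exact: iDC.
    by apply: (integrableZl _ (4 / t ^+ 2) (iDC 1 ltr01)); exact: mDC.
  move=> q; rewrite /closed_disk /= => /negP; rewrite -ltNge => q1.
  rewrite /peak expr1n mul1r mul1r; move: (sqn q) q1 => s s1.
  have ts : 0 < t ^+ 2 * s by rewrite mulr_gt0 ?exprn_gt0//; lra.
  have -> : 4 / t ^+ 2 * (1 + s) ^- 2 = 4 / (t ^+ 2 * (1 + s) ^+ 2).
    by field; rewrite !gt_eqF//; lra.
  rewrite ler_pdivrMr ?exprn_gt0//; last lra.
  rewrite mulrAC ler_pdivlMr; last by rewrite mulr_gt0 ?exprn_gt0//; lra.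
  have -> : t ^+ 2 * (t ^+ 2 * (1 + s) ^+ 2) = (t ^+ 2 * (1 + s)) ^+ 2 by ring.
  have -> : 4 * (1 + t ^+ 2 * s) ^+ 2 = (2 * (1 + t ^+ 2 * s)) ^+ 2 by ring.
  have t2 : 0 <= t ^+ 2 by exact: sqr_ge0.
  by rewrite ler_pXn2r ?nnegrE//; nra.
rewrite RintegralZl//; last exact: iDC.
have -> : 4 * pi / t ^+ 2 = 4 / t ^+ 2 * pi by rewrite mulrAC.
rewrite ler_wpM2l ?divr_ge0 ?sqr_ge0// -[leRHS](peak_integral_disk ltr01) lerDr.
by apply: Rintegral_ge0 => q _; exact: peak_ge0.
Qed.

(** Continuity at 0 gives the bound e near 0; elsewhere on the disk |q|^2 is
    bounded below, and a large C absorbs the oscillation of g. *)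
Lemma sublinear_modulus g : continuous g -> forall e, 0 < e ->
  exists2 C, 0 <= C & forall q, D q -> `|g q - g 0| <= e + C * sqn q.
Proof.
move=> cg e e0; have [M M0 gM] := continuous_disk_bounded cg.
have /cvgrPdist_le/(_ e e0) := cg 0.
move=> /nbhs_ballP[d /= d0 gd].
exists (2 * M / d ^+ 2); first by rewrite divr_ge0 ?sqr_ge0// mulr_ge0.
move=> q Dq; have s0 := sqn_ge0 q.
have [sd|sd] := ltP (sqn q) (d ^+ 2).
  apply: (@le_trans _ _ e).
    rewrite distrC; apply: gd.
    have lt_abs (x : R) : x ^+ 2 <= sqn q -> `|0 - x| < d.
      move=> xs; rewrite sub0r normrN -(@ltr_pXn2r _ 2) ?nnegrE//; last exact: ltW.
      by rewrite real_normK ?num_real//; exact: le_lt_trans sd.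
    by split; apply: lt_abs; rewrite /sqn ?lerDl ?lerDr sqr_ge0.
  by rewrite lerDl mulr_ge0// divr_ge0 ?sqr_ge0// mulr_ge0.
apply: (@le_trans _ _ (2 * M)).
  apply: le_trans (ler_normB _ _) _.
  have D0 : D 0 by rewrite /closed_disk /sqn /= expr0n/= addr0.
  by have := gM _ Dq; have := gM _ D0 => ? ?; lra.
apply: ler_wpDl; first exact: ltW.
rewrite -mulrA (mulrC _ (sqn q)) ler_peMr ?mulr_ge0//.
by rewrite ler_pdivlMr ?mul1r// exprn_gt0.
Qed.

Lemma continuousM2 f g : continuous f -> continuous g ->
  continuous (fun q => f q * g q).
Proof. by move=> cf cg q; apply: cvgM; [exact: cf|exact: cg]. Qed.

Lemma continuous_log_laplacian m : 10 <= m ->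
  continuous (log_laplacian m).
Proof.
have cdiff : continuous (fun q : R * R => q.1 ^+ 2 - q.2 ^+ 2).
  move=> q; apply: cvgB.
    apply: (@continuous_comp _ _ _ fst (fun z : R => z ^+ 2));
      [exact: cvg_fst|exact: exprn_continuous].
  apply: (@continuous_comp _ _ _ snd (fun z : R => z ^+ 2));
    [exact: cvg_snd|exact: exprn_continuous].
have csqn2 : continuous (fun q : R * R => sqn q ^+ 2).
  move=> q; apply: (@continuous_comp _ _ _ sqn (fun z : R => z ^+ 2));
    [exact: continuous_sqn|exact: exprn_continuous].
have cM (c : R) (f : R * R -> R) : continuous f -> continuous (fun q => c * f q).
  by move=> cf q; apply: cvgM; [exact: cvg_cst|exact: cf].
move=> m10 q; apply: cvgM.
  apply: cvgD; last by apply: cM; exact: continuous_sqn.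
  apply: (cM _ (fun q => _ - _)) => {}q; apply: cvgB; last exact: cM.
  by apply: cvgD; [exact: cvg_cst|exact: csqn2].
apply: cvgV; first by rewrite expf_neq0// gt_eqF// real_potential_gt0.
apply: (@continuous_comp _ _ _ (real_potential m) (fun z : R => z ^+ 2));
  last exact: exprn_continuous.
apply: cvgD; last exact: cM.
apply: cvgD; last exact: csqn2.
by apply: cvgD; [exact: cvg_cst|apply: cM; exact: continuous_sqn].
Qed.

End disk.

(** * Concentration at the origin *)

Section concentration.
Context {R : realType}.
Notation mu := (@lebesgue_measure R).
Notation mu2 := (mu \x mu)%E.
Notation D := (@closed_disk R).
Implicit Types (f g : R * R -> R) (q : R * R) (m t : R).

(** The term C r of the modulus of continuity costs nothing new, as r times the
    peak is at most 1 / (1 + m^2 r). *)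
Lemma concentration_pointwise g m q M C e : 10 <= m -> D q -> `|g q| <= M ->
    `|g q - g 0| <= e + C * sqn q -> 0 <= C -> 
  `|g q * log_laplacian m q - g 0 * peak m (sqn q)|
    <= (82 * M + C) * (m / (1 + m ^+ 2 * sqn q)) + e * peak m (sqn q).
Proof.
move=> m10 Dq gM gC C0; have [m0 m5 _] := large_m m10.
have s0 := sqn_ge0 q.
have approx := peak_approx m10 (coef_p_ge0 m0) (coef_p_le m0 m5) s0 Dq
  (norm_sqrB_le q).
rewrite -/(log_laplacian_num m q) -/(real_potential m q) in approx.
rewrite -/(log_laplacian m q) in approx.
have K0 := peak_ge0 m (sqn q).
rewrite (_ : _ - _ = g q * (log_laplacian m q - peak m (sqn q))
                     + (g q - g 0) * peak m (sqn q)); last by ring.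
apply: le_trans (ler_normD _ _) _.
rewrite [X in X + _]normrM [X in _ + X]normrM (ger0_norm K0).
have h1 : `|g q| * `|log_laplacian m q - peak m (sqn q)|
    <= M * (82 * (m / (1 + m ^+ 2 * sqn q))) by rewrite ler_pM.
have h2 : `|g q - g 0| * peak m (sqn q) <= (e + C * sqn q) * peak m (sqn q).
  by rewrite ler_wpM2r.
have P1 : 1 <= 1 + m ^+ 2 * sqn q by rewrite lerDl mulr_ge0 ?sqr_ge0.
have h3 : sqn q * peak m (sqn q) <= m / (1 + m ^+ 2 * sqn q).
  rewrite /peak; move: (sqn q) s0 P1 => s s0; set P := 1 + _ => P1.
  have P0 : 0 < P by lra.
  apply: (@le_trans _ _ P^-1).
    rewrite mulrA ler_pdivrMr ?exprn_gt0//.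
    rewrite (_ : P^-1 * P ^+ 2 = P); last by field; rewrite gt_eqF.
    by rewrite /P mulrC lerDr.
  by rewrite -[leLHS]mul1r ler_wpM2r ?invr_ge0; lra.
have h4 := ler_wpM2l C0 h3.
move: h1 h2 h4; move: (peak _ _) (m / _) => K E; lra.
Qed.

(** The parameter m is taken of the form t^2 because [tail_le_peaks] compares
    the scales t^2 and t.  The constant 3 pi + 4 bounds the integral over the
    disk of the peaks of that lemma, each of mass at most pi, and of 1, the disk
    having area at most 4. *)
Lemma concentration_bound g t M C e : 4 <= t -> continuous g ->
    (forall q, D q -> `|g q| <= M) ->
    (forall q, D q -> `|g q - g 0| <= e + C * sqn q) ->
    0 <= M -> 0 <= C -> 0 <= e ->
  `|\int[mu2]_(q in D) (g q * log_laplacian (t ^+ 2) q) - pi * g 0|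
    <= t^-1 * ((82 * M + C) * (3 * pi + 4) + 4 * pi * `|g 0|) + e * pi.
Proof.
move=> t4 cg gM gC M0 C0 e0.
have t0 : 0 < t by lra.
have t1 : 1 <= t by lra.
have m10 : 10 <= t ^+ 2 by rewrite expr2; nra.
have m0 : 0 < t ^+ 2 by rewrite exprn_gt0.
set m := t ^+ 2 in m10 m0 *.
have pi0 : 0 < pi :> R := pi_gt0 R.
have cF := continuous_log_laplacian m10.
have cK s : continuous (fun q : R * R => peak s (sqn q)) by exact: continuous_peak.
have cc c : continuous (fun q : R * R => c : R) by move=> q; exact: cvg_cst.
have mD := measurable_disk (R := R).
have i1 := integrable_disk (continuousM2 cg cF).
have i2 := integrable_disk (continuousM2 (cc (g 0)) (cK m)).
pose S q := peak m (sqn q) + 2 * peak t (sqn q) + 1.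
have cS : continuous S.
  move=> q; apply: cvgD; last exact: cvg_cst.
  by apply: cvgD; [exact: cK|exact: continuousM2 (cc 2) (cK t) q].
pose B q := (82 * M + C) * t^-1 * S q + e * peak m (sqn q).
have cB : continuous B.
  by move=> q; apply: cvgD; [exact: continuousM2 (cc _) cS q|
    exact: continuousM2 (cc e) (cK m) q].
have IS : \int[mu2]_(q in D) S q <= 3 * pi + 4.
  have -> : \int[mu2]_(q in D) S q = \int[mu2]_(q in D) peak m (sqn q)
     + 2 * \int[mu2]_(q in D) peak t (sqn q) + \int[mu2]_(q in D) 1.
    rewrite RintegralD//; last 2 first.
    - apply: integrable_disk => q; apply: cvgD; first exact: cK.
      exact: continuousM2 (cc 2) (cK t) q.
    - exact: integrable_disk (cc 1).
    rewrite RintegralD//; last 2 first.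
    - exact: integrable_disk (cK m).
    - exact: integrable_disk (continuousM2 (cc 2) (cK t)).
    by rewrite RintegralZl//; exact: integrable_disk (cK t).
  have a1 := peak_integral_disk_le m0; have a2 := peak_integral_disk_le t0.
  have a3 : \int[mu2]_(q in D) 1 <= 4.
    rewrite Rintegral_cst// mul1r -[leRHS]/(fine 4%:E).
    rewrite fine_le ?disk_measure_le//.
    by rewrite ge0_fin_numE// (le_lt_trans disk_measure_le)// ltry.
  rewrite (_ : 3 * pi + 4 = pi + 2 * pi + 4); last by ring.
  by rewrite !lerD// ler_wpM2l.
have IB : \int[mu2]_(q in D) B q <= t^-1 * ((82 * M + C) * (3 * pi + 4)) + e * pi.
  rewrite RintegralD//; last 2 first.
  - exact: integrable_disk (continuousM2 (cc _) cS).
  - exact: integrable_disk (continuousM2 (cc _) (cK m)).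
  rewrite [X in X + _]RintegralZl//; last exact: integrable_disk cS.
  rewrite [X in _ + X]RintegralZl//; last exact: integrable_disk (cK m).
  rewrite lerD//; last by apply: ler_wpM2l => //; exact: peak_integral_disk_le m0.
  rewrite (mulrC (82 * M + C)) -mulrA ler_wpM2l ?invr_ge0 ?(ltW t0)//.
  by rewrite ler_wpM2l// addr_ge0 ?mulr_ge0.
have I12 : `|\int[mu2]_(q in D) (g q * log_laplacian m q)
    - g 0 * \int[mu2]_(q in D) peak m (sqn q)| <= \int[mu2]_(q in D) B q.
  rewrite -RintegralZl//; last exact: integrable_disk (cK m).
  rewrite -RintegralB//.
  have cD : continuous (fun q => g q * log_laplacian m q - g 0 * peak m (sqn q)).
    by move=> q; apply: cvgB;
      [exact: continuousM2 cg cF q|exact: continuousM2 (cc _) (cK m) q].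
  have iD := integrable_disk cD.
  apply: le_trans (le_normr_Rintegral _ iD) _ => //.
  apply: le_Rintegral => //.
  - apply: integrable_disk => q; apply: (@continuous_comp _ _ _
      (fun q => g q * log_laplacian m q - g 0 * peak m (sqn q)) Num.norm).
      exact: cD.
    exact: norm_continuous.
  - exact: integrable_disk.
  move=> q Dq.
  apply: le_trans (concentration_pointwise m10 Dq (gM q Dq) (gC q Dq) C0) _.
  rewrite lerD2r -mulrA ler_wpM2l ?addr_ge0 ?mulr_ge0//.
  exact: tail_le_peaks t1 (sqn_ge0 q).
have Ipi : `|g 0 * \int[mu2]_(q in D) peak m (sqn q) - pi * g 0|
    <= t^-1 * (4 * pi * `|g 0|).
  rewrite mulrC -mulrBl normrM mulrA ler_wpM2r//.
  have lo := peak_integral_disk_ge m0; have hi := peak_integral_disk_le m0.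
  have tm : 4 * pi / m ^+ 2 <= t^-1 * (4 * pi).
    rewrite mulrC ler_wpM2r ?mulr_ge0 ?(ltW pi0)//.
    rewrite lef_pV2 ?posrE ?exprn_gt0//.
    rewrite /m -exprM; exact: ler_eXnr.
  rewrite distrC ger0_norm ?subr_ge0//.
  by apply: le_trans tm; rewrite lerBlDl -lerBlDr.
rewrite (_ : _ - pi * g 0 =
  (\int[mu2]_(q in D) (g q * log_laplacian m q)
    - g 0 * \int[mu2]_(q in D) peak m (sqn q))
  + (g 0 * \int[mu2]_(q in D) peak m (sqn q) - pi * g 0)); last by ring.
apply: le_trans (ler_normD _ _) _.
rewrite mulrDr addrAC lerD//; exact: le_trans I12 IB.
Qed.

Lemma RP2_class_continuous : continuous (@RP2_class R).
Proof.
move=> q; apply: (@continuous_comp _ _ _ (Some : R * R -> S2 R)).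
  exact: one_point_compactification_some_continuous.
exact: pi_continuous.
Qed.

Lemma RP2_integral_split (h u : RP2 R -> R) (m : R) : 10 <= m ->
    conformal_factor m h -> continuous u ->
  RP2_integral (fun x => u x * h x) = 3 * RP2_integral u +
    4 * \int[mu2]_(q in D) (u (RP2_class q) * log_laplacian m q).
Proof.
move=> m10 hm cu; rewrite /RP2_integral.
have cg : continuous (u \o RP2_class).
  by move=> q; apply: continuous_comp; [exact: RP2_class_continuous|exact: cu].
have cc c : continuous (fun q : R * R => c : R) by move=> q; exact: cvg_cst.
have ca : continuous (fun q : R * R => 4 / (1 + sqn q) ^+ 2).
  rewrite (_ : (fun q => _) = (fun q => 4 * peak 1 (sqn q))); last first.
    by apply/funext => q; rewrite /peak expr1n !mul1r.
  exact: continuousM2 (cc 4) (@continuous_peak R 1).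
have i1 := integrable_disk (continuousM2 cg ca).
have i2 := integrable_disk (continuousM2 cg (continuous_log_laplacian m10)).
have mD := measurable_disk (R := R).
rewrite -RintegralZl// -RintegralZl// -RintegralD//; first last.
- apply: integrable_disk.
  exact: continuousM2 (cc 4) (continuousM2 cg (continuous_log_laplacian m10)).
- exact: integrable_disk (continuousM2 (cc 3) (continuousM2 cg ca)).
apply: eq_Rintegral => q _.
rewrite -mulrA (conformal_factorE _ m10 hm) /=.
move: (log_laplacian _ _) (_ ^+ 2) => F s; ring.
Qed.

End concentration.

Theorem proposition6p6 (R : realType) (h : R -> RP2 R -> R)
    (hE : forall m : R, Num.sqrt (5 / 3) < m -> conformal_factor m (h m))
    (u : RP2 R -> R) (u_cont : continuous u) :
  RP2_integral (fun x => u x * h m x) @[m --> +oo] -->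
    4 * pi * u (RP2_class 0) + 3 * RP2_integral u.
Proof.
pose g := u \o @RP2_class R.
have cg : continuous g.
  by move=> q; apply: continuous_comp; [exact: RP2_class_continuous|exact: u_cont].
have [M M0 gM] := continuous_disk_bounded cg.
have pi0 : 0 < pi :> R := pi_gt0 R.
apply/cvgrPdist_le => e e0.
(* The error of [concentration_bound] is counted four times, and is the sum of
   e1 * pi = e / 8 and of Y / sqrt m, which T makes at most e / 8 as well. *)
have e1 : 0 < e / (8 * pi) by rewrite divr_gt0// mulr_gt0.
have [C C0 gC] := sublinear_modulus cg e1.
pose Y := (82 * M + C) * (3 * pi + 4) + 4 * pi * `|g 0|.
have Y0 : 0 <= Y.
  apply: addr_ge0; last by rewrite mulr_ge0// mulr_ge0// ltW.
  rewrite mulr_ge0//; first by rewrite addr_ge0// mulr_ge0.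
  by rewrite addr_ge0// mulr_ge0// ltW.
pose T := 4 + 8 * Y / e.
have T4 : 4 <= T by rewrite lerDl divr_ge0 ?mulr_ge0// ltW.
near=> m.
have mT : T ^+ 2 <= m by near: m; apply: nbhs_pinfty_ge; rewrite num_real.
have m0 : 0 <= m by apply: le_trans mT; exact: sqr_ge0.
have m10 : 10 <= m.
  apply: le_trans mT; apply: (@le_trans _ _ (4 ^+ 2)); first lra.
  by rewrite ler_pXn2r ?nnegrE//; apply: le_trans T4.
have tT : T <= Num.sqrt m.
  rewrite -(@ler_pXn2r _ 2) ?nnegrE ?sqrtr_ge0//; last exact: le_trans T4.
  by rewrite sqr_sqrtr.
have [_ _ /hE hm] := large_m m10.
rewrite (RP2_integral_split m10 hm u_cont).
have := concentration_bound (le_trans T4 tT) cg gM gC M0 C0 (ltW e1).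
rewrite sqr_sqrtr// -/Y => bound.
have YT : (Num.sqrt m)^-1 * Y <= e / 8.
  have t0 : 0 < Num.sqrt m by apply: lt_le_trans tT; apply: lt_le_trans T4.
  rewrite ler_pdivrMl//.
  apply: (@le_trans _ _ (T * (e / 8))); last by rewrite ler_wpM2r// divr_ge0// ltW.
  rewrite /T mulrDl (_ : 8 * Y / e * (e / 8) = Y); last by field; rewrite gt_eqF.
  by rewrite lerDr mulr_ge0// divr_ge0// ltW.
have eE (p : R) : 0 < p -> e / (8 * p) * p = e / 8.
  by move=> p0; field; rewrite gt_eqF.
rewrite eE// in bound.
rewrite (_ : _ - _ = - (4 * (\int[(lebesgue_measure \x lebesgue_measure)%E]_(q in closed_disk)
   (u (RP2_class q) * log_laplacian m q) - pi * g 0))); last first.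
  by rewrite /g /=; ring.
rewrite normrN normrM ger0_norm//.
apply: (@le_trans _ _ (4 * (e / 8 + e / 8))); last first.
  by rewrite [leLHS](_ : _ = e)//; field.
rewrite ler_wpM2l//; apply: le_trans bound _.
by rewrite lerD2r.
Unshelve. all: by end_near. Qed.
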